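(* Let $d\ge 1$ and $n\ge 2$ be integers, and let $\mathcal G_1,\dots,\mathcal G_{d+1}$ be $n$-adic grids in $\mathbb{R}^d$, each written as $\mathcal G_i=\mathcal G(\delta_i,\mathcal L_{\vec{\mathbf a}_i})$ for some $\delta_i\in\mathbb{R}^d$ and some infinite matrix $\vec{\mathbf a}_i$ with $d$ rows, infinitely many columns and entries in $\{0,\dots,n-1\}$. Then the collection $\mathcal G_1,\dots,\mathcal G_{d+1}$ is adjacent (in $\mathbb{R}^d$) if and only if for any $j\in\{1,\dots,d\}$ and any $k_1,k_2\in\{1,\dots,d+1\}$ with $k_1\ne k_2$, the grids $P_j(\mathcal G_{k_1})$ and $P_j(\mathcal G_{k_2})$ are adjacent on $\mathbb{R}$.
   Context: Throughout, $\mathbb{N}=\{0,1,2,\dots\}$, and $(v)_s$ denotes the $s$-th component of $v\in\mathbb{R}^d$. Cubes are axis-parallel, and $\ell(Q)>0$ denotes the sidelength of a cube $Q$ (on $\mathbb{R}$, cubes are intervals). An $n$-adic grid in $\mathbb{R}^d$ is a collection $\mathcal G$ of left-closed, right-open cubes $[a_1,a_1+\ell)\times\dots\times[a_d,a_d+\ell)$ such that: (i) every $Q\in\mathcal G$ has sidelength $n^k$ for some $k\in\mathbb{Z}$; (ii) $Q\cap R\in\{Q,R,\emptyset\}$ for all $Q,R\in\mathcal G$; (iii) for each fixed $k\in\mathbb{Z}$, the cubes in $\mathcal G$ of sidelength $n^k$ form a partition of $\mathbb{R}^d$. Location function: for an infinite matrix $\vec{\mathbf a}=\{\vec a_0,\vec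 a_1,\dots\}$ with columns $\vec a_j\in\{0,\dots,n-1\}^d$ ($j\ge 0$), define $\mathcal L_{\vec{\mathbf a}}:\mathbb{N}\to\mathbb{Z}^d$ by $\mathcal L_{\vec{\mathbf a}}(0)=\vec 0$ and $\mathcal L_{\vec{\mathbf a}}(j)=\sum_{i=0}^{j-1}n^i\vec a_i$ for $j\ge 1$. The grid $\mathcal G(\delta,\mathcal L_{\vec{\mathbf a}})$: for $\delta\in\mathbb{R}^d$ it is the union over $m\in\mathbb{Z}$ of the $m$-th generations, where the $m$-th generation consists of all cubes $$\prod_{s=1}^d\left[(v_m)_s+\frac{k_s}{n^m},\,(v_m)_s+\frac{k_s+1}{n^m}\right),\qquad (k_1,\dots,k_d)\in\mathbb{Z}^d,$$ with $v_m=\delta$ for $m\ge 0$ and $v_m=\delta+\mathcal L_{\vec{\mathbf a}}(-m)$ for $m<0$. Adjacency: $d+1$ $n$-adic grids $\mathcal G_1,\dots,\mathcal G_{d+1}$ in $\mathbb{R}^d$ are adjacent if there is a constant $C>0$ (independent of $Q$) such that for every cube $Q\subseteq\mathbb{R}^d$ (equivalently, every ball) there exist $i\in\{1,\dots,d+1\}$ and $R\in\mathcal G_i$ with $Q\subseteq R$ and $\ell(R)\le C\,\ell(Q)$. Adjacency of two $n$-adic grids on $\mathbb{R}$ is the case $d=1$ of this definition. $P_j$ is the orthogonal projection onto the $j$-th coordinate axis of $\mathbb{R}^d$ (identified with $\mathbb{R}$), and $P_j(\mathcal G)=\{P_j(Q):Q\in\mathcal G\}$. *)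

(* Defs.v *)
From mathcomp Require Import all_boot all_order all_algebra.
From mathcomp Require Import all_classical all_reals.
Set Implicit Arguments.
Unset Strict Implicit.
Unset Printing Implicit Defensive.
Import Order.TTheory GRing.Theory Num.Theory.
Local Open Scope classical_set_scope.
Local Open Scope ring_scope.

Definition hocube (R : realType) (d : nat) (a : 'rV[R]_d) (l : R)
    : set 'rV[R]_d :=
  [set x : 'rV[R]_d | forall s, x 0 s \in `[a 0 s, a 0 s + l[ ].

(* [Q] is an axis-parallel cube of sidelength [l].  No convention is imposed on
   the faces: [b s] and [c s] say whether the s-th lower face is included and
   whether the s-th upper face is excluded.  For [0 < d], [l] is determined by
   [Q]. *)
Definition is_cube (R : realType) (d : nat) (Q : set 'rV[R]_d) (l : R) : Prop :=
  0 < l /\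
  exists (a : 'rV[R]_d) (b c : 'I_d -> bool),
    Q = [set x : 'rV[R]_d | forall s,
           x 0 s \in Interval (BSide (b s) (a 0 s)) (BSide (c s) (a 0 s + l))].

Definition nadic_grid (R : realType) (d n : nat) (G : set (set 'rV[R]_d))
    : Prop :=
  [/\ forall Q, G Q -> exists (a : 'rV[R]_d) (k : int), Q = hocube a (n%:R ^ k),
      forall Q S, G Q -> G S ->
        [\/ Q `&` S = Q, Q `&` S = S | Q `&` S = set0]
    & forall k : int,
        partition [set Q | G Q /\ exists a : 'rV[R]_d, Q = hocube a (n%:R ^ k)]
          id setT].

(* The columns of the infinite matrix are represented as row vectors [a j]. *)
Definition location (d n : nat) (a : nat -> 'rV['I_n]_d) (j : nat)
    : 'rV[int]_d :=
  \row_s \sum_(i < j) (n ^ i * a i 0%R s)%N%:Z.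

Definition offset (R : realType) (d : nat) (delta : 'rV[R]_d)
    (L : nat -> 'rV[int]_d) (m : int) : 'rV[R]_d :=
  if 0 <= m then delta
  else delta + map_mx (fun z : int => z%:~R) (L `|m|%N).

Definition generation (R : realType) (d n : nat) (delta : 'rV[R]_d)
    (L : nat -> 'rV[int]_d) (m : int) : set (set 'rV[R]_d) :=
  [set Q : set 'rV[R]_d | exists k : 'rV[int]_d,
     Q = [set x : 'rV[R]_d | forall s, x 0 s \in
            `[offset delta L m 0 s + (k 0 s)%:~R / n%:R ^ m,
              offset delta L m 0 s + (k 0 s + 1)%:~R / n%:R ^ m[ ]].

Definition grid (R : realType) (d n : nat) (delta : 'rV[R]_d)
    (L : nat -> 'rV[int]_d) : set (set 'rV[R]_d) :=
  \bigcup_(m in [set: int]) generation n delta L m.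

Definition adjacent (R : realType) (d n : nat)
    (G : 'I_d.+1 -> set (set 'rV[R]_d)) : Prop :=
  (forall i, nadic_grid n (G i)) /\
  exists2 C : R, 0 < C &
    forall (Q : set 'rV[R]_d) (l : R), is_cube Q l ->
      exists (i : 'I_d.+1) (S : set 'rV[R]_d) (r : R),
        [/\ G i S, is_cube S r, Q `<=` S & r <= C * l].

(* Adjacency of two grids on the line, which is identified with 'rV[R]_1. *)
Definition adjacent2 (R : realType) (n : nat) (G H : set (set 'rV[R]_1))
    : Prop :=
  adjacent n (fun i : 'I_2 => if i == ord0 then G else H).

Definition coord_proj (R : realType) (d : nat) (j : 'I_d) (x : 'rV[R]_d)
    : 'rV[R]_1 :=
  \row_(_ < 1) x 0 j.

Definition grid_proj (R : realType) (d : nat) (j : 'I_d)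
    (G : set (set 'rV[R]_d)) : set (set 'rV[R]_1) :=
  [set coord_proj j @` Q | Q in G].

(* Main.v *)
Require Import Defs.
From mathcomp Require Import all_boot all_order all_algebra.
From mathcomp Require Import all_classical all_reals.
From mathcomp Require Import perm ring lra zify.
Set Implicit Arguments.
Unset Strict Implicit.
Import Order.TTheory GRing.Theory Num.Theory.
Local Open Scope classical_set_scope.
Local Open Scope ring_scope.

(** Every generation of a grid [grid n delta (location a)] is a product of
    one-dimensional partitions, so it is described by its index map
    [cell_index]: the cubes of generation [m] are the fibres of that map, and
    a set lies in one of them exactly when each coordinate of the index is
    constant on it.  Cells are nested: a coordinate of the index at generation
    [m + 1] determines it at generation [m] ([cell_index_step]), because the
    offsets of the two generations differ by a multiple of [n ^ - (m + 1)].
    Hence a set lies in a grid cube of side at most [n ^ - m] only if the index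
    of generation [m] is constant on it ([grid_cube_same_index]), and the
    converse is clear ([same_index_grid_cube]).  Both directions of the
    theorem compare a cube of side [l] with a generation whose side is
    comparable to [C * l].

    Suppose that all pairs of projections are adjacent with the same constant
    [C], and let [Q] be a cube of side [l].  For each coordinate [j], at most
    one of the [d + 1] grids separates points of [Q] in the coordinate [j]: two
    such grids would contradict the adjacency of their projections, tested on
    the projection of [Q].  The [d] coordinates therefore exclude at most [d]
    grids, and a cube of a remaining grid contains [Q]
    ([proj_adjacent_adjacent]).

    Conversely, suppose that the [d + 1] grids are adjacent in dimension [d],
    and let [I] be an interval to be captured by the projection to the axis
    [j] of one of the grids [k1], [k2].  The other [d - 1] grids are matched
    with the other [d - 1] coordinates, and [I] is completed to a cube [Q] which
    has, in each coordinate other than [j], a cell boundary of the matched grid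
    in its interior.  None of these grids can capture [Q], so [k1] or [k2] does,
    and projecting gives the result ([adjacent_proj_adjacent]). *)

(** * The index of a cell *)

Definition cell_index {R : realType} {d n : nat} (delta : 'rV[R]_d)
    (a : nat -> 'rV['I_n]_d) (m : int) (x : 'rV[R]_d) : 'rV[int]_d :=
  \row_s Num.floor ((x 0 s - offset delta (location a) m 0 s) * n%:R ^ m).

Lemma natr_exprz_gt0 (R : realType) (n : nat) (m : int) :
  (2 <= n)%N -> 0 < n%:R ^ m :> R.
Proof. by move=> n2; rewrite exprz_gt0// ltr0n; lia. Qed.

Lemma itv_floor (R : realType) (o N t : R) (k : int) : 0 < N ->
  (t \in `[o + k%:~R / N, o + (k + 1)%:~R / N[) =
  (Num.floor ((t - o) * N) == k).
Proof.
move=> N0.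
have -> : (t \in `[o + k%:~R / N, o + (k + 1)%:~R / N[) =
          (k%:~R <= (t - o) * N < (k + 1)%:~R).
  by rewrite in_itv/= -lerBrDl -ltrBlDl ler_pdivrMr// ltr_pdivlMr.
apply/idP/eqP => [/floor_def//|<-].
by rewrite Num.Theory.floor_itv.
Qed.

Lemma generationE (R : realType) (d n : nat) (n2 : (2 <= n)%N)
    (delta : 'rV[R]_d) (a : nat -> 'rV['I_n]_d) (m : int) :
  generation n delta (location a) m =
  [set Q | exists k, Q = [set x | cell_index delta a m x = k]].
Proof.
have E (k : 'rV[int]_d) : [set x : 'rV[R]_d | forall s, x 0 s \in
    `[offset delta (location a) m 0 s + (k 0 s)%:~R / n%:R ^ m,
      offset delta (location a) m 0 s + (k 0 s + 1)%:~R / n%:R ^ m[ ] =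
    [set x | cell_index delta a m x = k].
  apply/seteqP; split=> x /= xk.
    apply/rowP => s; rewrite mxE; apply/eqP.
    by rewrite -itv_floor ?natr_exprz_gt0.
  by move=> s; rewrite itv_floor ?natr_exprz_gt0// -xk mxE.
by apply/seteqP; split=> Q [k ->]; exists k; rewrite E.
Qed.

Lemma generation_hocube (R : realType) (d n : nat)
    (delta : 'rV[R]_d) (a : nat -> 'rV['I_n]_d) (m : int) (Q : set 'rV[R]_d) :
  generation n delta (location a) m Q -> exists b, Q = hocube b (n%:R ^ (- m)).
Proof.
case=> k ->.
exists (\row_s (offset delta (location a) m 0 s + (k 0 s)%:~R / n%:R ^ m)).
apply/seteqP; split=> x /= + s => /(_ s); rewrite !mxE.
  by rewrite -addrA intrD mulrDl mul1r invr_expz.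
by rewrite -addrA intrD mulrDl mul1r invr_expz.
Qed.

(** Consecutive offsets agree modulo the finer mesh: they are equal for [m >= 0],
    and for [m < 0] the generation [m] adds one more digit, that is an integer
    multiple of the side of the cubes of generation [m + 1]. *)
Lemma offset_step (R : realType) (d n : nat) (n2 : (2 <= n)%N)
    (delta : 'rV[R]_d) (a : nat -> 'rV['I_n]_d) (m : int) (s : 'I_d) :
  exists z : int, (offset delta (location a) m 0 s -
     offset delta (location a) (m + 1) 0 s) * n%:R ^ (m + 1) = z%:~R.
Proof.
case: m => [m|j].
  exists 0; rewrite /offset; have -> : 0 <= m%:Z + 1 by lia.
  by rewrite subrr mul0r.
have n0 : n%:R != 0 :> R by rewrite pnatr_eq0; lia.
have -> : Negz j + 1 = - j%:Z by lia.
have -> : offset delta (location a) (- j%:Z) =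
    delta + map_mx (fun z : int => z%:~R) (location a j).
  case: j => [|j]; rewrite /offset/= ?abszN// .
  by apply/rowP => i; rewrite !mxE big_ord0 addr0.
rewrite /offset /= /location !mxE big_ord_recr/= intrD.
exists (a j 0 s : nat).
rewrite opprD addrACA subrr add0r [X in X * _]addrAC subrr add0r.
rewrite PoszM intrM mulrAC -[RHS]mul1r; congr (_ * _).
by rewrite -invr_expz -exprnP -pmulrn natrX divff// expf_neq0.
Qed.

(** An integer [k] is at most [(u + z) / n] iff the integer [k * n - z] is at most
    [u], and the latter condition only sees the floor of [u]. *)
Lemma floor_div_eq (R : realType) (n : nat) (z : int) (u v : R) :
  (2 <= n)%N -> Num.floor u = Num.floor v ->
  Num.floor ((u + z%:~R) / n%:R) = Num.floor ((v + z%:~R) / n%:R).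
Proof.
move=> n2 uv.
have n0 : 0 < n%:R :> R by rewrite ltr0n; lia.
have H (w : R) k : (k <= Num.floor ((w + z%:~R) / n%:R)) =
                   (k * n%:Z - z <= Num.floor w).
  rewrite !Num.Theory.floor_ge_int ler_pdivlMr//.
  by rewrite -lerBlDr rmorphB/= rmorphM/= -pmulrn.
apply/eqP; rewrite eq_le H -uv -H lexx /=.
by rewrite H uv -H.
Qed.

(** Rescaling from generation [m + 1] to [m] is division by [n] after an integer
    shift, which floors respect.  The property holds coordinate by coordinate,
    and this is the form that both directions of the theorem use. *)
Lemma cell_index_step (R : realType) (d n : nat) (n2 : (2 <= n)%N)
    (delta : 'rV[R]_d) (a : nat -> 'rV['I_n]_d) (m : int) (s : 'I_d)
    (x y : 'rV[R]_d) :
  cell_index delta a (m + 1) x 0 s = cell_index delta a (m + 1) y 0 s ->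
  cell_index delta a m x 0 s = cell_index delta a m y 0 s.
Proof.
rewrite !mxE.
have [z hz] := offset_step n2 delta a m s.
move=> /(floor_div_eq (- z) n2).
have n0 : n%:R != 0 :> R by rewrite pnatr_eq0; lia.
have E (t : R) : ((t - offset delta (location a) (m + 1) 0 s) * n%:R ^ (m + 1)
   + (- z)%:~R) / n%:R = (t - offset delta (location a) m 0 s) * n%:R ^ m.
  rewrite rmorphN/= -hz -mulrBl expfzDr// mulrA mulfK//.
  by congr (_ * _); ring.
by rewrite !E.
Qed.

Lemma cell_index_coarsen (R : realType) (d n : nat) (n2 : (2 <= n)%N)
    (delta : 'rV[R]_d) (a : nat -> 'rV['I_n]_d) (m m' : int) (s : 'I_d)
    (x y : 'rV[R]_d) : m <= m' ->
  cell_index delta a m' x 0 s = cell_index delta a m' y 0 s ->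
  cell_index delta a m x 0 s = cell_index delta a m y 0 s.
Proof.
move=> mm'; have -> : m' = m + `|m' - m|%N by lia.
elim: `|m' - m|%N => [|k IH]; first by rewrite addr0.
by rewrite -[k.+1]addn1 PoszD addrA => /cell_index_step -/(_ n2)/IH.
Qed.

(** * Sidelengths *)

Lemma cube_diameter (R : realType) (d : nat) (Q : set 'rV[R]_d) (l : R)
    (x y : 'rV[R]_d) (s : 'I_d) :
  is_cube Q l -> Q x -> Q y -> y 0 s - x 0 s <= l.
Proof.
case=> l0 [a [b [c ->]]] /= /(_ s) + /(_ s).
by case: (b s) (c s) => -[]; rewrite !in_itv/= => /andP[? ?] /andP[? ?]; lra.
Qed.

Lemma hocube_is_cube (R : realType) (d : nat) (b : 'rV[R]_d) (l : R) :
  0 < l -> is_cube (hocube b l) l.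
Proof. by move=> l0; split=> //; exists b, (fun=> true), (fun=> true). Qed.

(** The predicate [is_cube] mentions a sidelength without recording that the set
    determines it.  This bound recovers what is needed: if [r < l], the corner
    and the point at distance [(l + r) / 2] from it violate the diameter
    bound. *)
Lemma hocube_le_side (R : realType) (d : nat) (d0 : (0 < d)%N) (b : 'rV[R]_d)
    (l r : R) : is_cube (hocube b l) r -> l <= r.
Proof.
move=> cS; have r0 : 0 < r by case: cS.
rewrite leNgt; apply/negP => rl.
have ob : hocube b l b by move=> s; rewrite in_itv/=; lra.
have oy : hocube b l (\row_s (b 0 s + (l + r) / 2)).
  by move=> s; rewrite mxE in_itv/=; lra.
by have := cube_diameter (Ordinal d0) cS ob oy; rewrite mxE; lra.
Qed.

Lemma hocube_side_inj (R : realType) (d : nat) (d0 : (0 < d)%N)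
    (b c : 'rV[R]_d) (l r : R) :
  0 < l -> 0 < r -> hocube b l = hocube c r -> l = r.
Proof.
move=> l0 r0 E; apply/eqP; rewrite eq_le.
rewrite (hocube_le_side d0 (b:=b)) 1?E ?(hocube_le_side d0 (b:=c)) -1?E//.
  exact: hocube_is_cube.
by rewrite E; exact: hocube_is_cube.
Qed.

(** * Cubes contained in grid cubes *)

(** A grid cube of side at most [n ^ - m] belongs to a generation at least [m],
    so nestedness puts it in a single cell of generation [m]. *)
Lemma grid_cube_same_index (R : realType) (d n : nat) (d0 : (0 < d)%N)
    (n2 : (2 <= n)%N) (delta : 'rV[R]_d) (a : nat -> 'rV['I_n]_d)
    (S : set 'rV[R]_d) (r : R) (m : int) (x y : 'rV[R]_d) (s : 'I_d) :
  grid n delta (location a) S -> is_cube S r -> r <= n%:R ^ (- m) ->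
  S x -> S y -> cell_index delta a m x 0 s = cell_index delta a m y 0 s.
Proof.
case=> m' _ gS cS rm Sx Sy.
have mm' : m <= m'.
  have [b Sb] := generation_hocube gS.
  move: cS; rewrite Sb => /(hocube_le_side d0) /le_trans /(_ rm).
  by rewrite ler_eXz2l ?lerN2// ltr1n.
apply: (cell_index_coarsen n2 mm').
by move: gS Sx Sy; rewrite generationE// => -[k ->] /= -> ->.
Qed.

Lemma same_index_grid_cube (R : realType) (d n : nat)
    (n2 : (2 <= n)%N) (delta : 'rV[R]_d) (a : nat -> 'rV['I_n]_d)
    (Q : set 'rV[R]_d) (m : int) :
  Q !=set0 ->
  (forall x y s, Q x -> Q y ->
     cell_index delta a m x 0 s = cell_index delta a m y 0 s) ->
  exists S,
    [/\ grid n delta (location a) S, is_cube S (n%:R ^ (- m)) & Q `<=` S].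
Proof.
move=> [z Qz] Qm.
have gS : generation n delta (location a) m
    [set x | cell_index delta a m x = cell_index delta a m z].
  by rewrite generationE//; eexists.
eexists; split; first by exists m => //; exact: gS.
  have [b ->] := generation_hocube gS.
  by apply: hocube_is_cube; exact: natr_exprz_gt0.
by move=> x Qx /=; apply/rowP => s; exact: Qm.
Qed.

(** For the partition property, the cubes of side [n ^ k] are those of generation
    [- k], because a cube determines its sidelength and [n >= 2]. *)
Lemma grid_is_nadic (R : realType) (d n : nat) (d0 : (0 < d)%N)
    (n2 : (2 <= n)%N) (delta : 'rV[R]_d) (a : nat -> 'rV['I_n]_d) :
  nadic_grid n (grid n delta (location a)).
Proof.
split.
- by move=> Q [m _ /generation_hocube[b ->]]; exists b, (- m).
- have nested m m' Q S : m <= m' -> generation n delta (location a) m Q ->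
     generation n delta (location a) m' S -> Q `&` S = S \/ Q `&` S = set0.
    rewrite !generationE// => mm' [k ->] [k' ->].
    set Q' := (X in X `&` _); set S' := (X in _ `&` X).
    have [[x [/= Qx Sx]]|/set0P/negP/negPn/eqP] := pselect (Q' `&` S' !=set0).
      left; apply/setIidPr => y /= Sy; rewrite /Q' /= -Qx.
      apply/rowP => s; apply: (cell_index_coarsen n2 mm').
      by rewrite Sx Sy.
    by right.
  move=> Q S [m _ gQ] [m' _ gS].
  have [mm'|/ltW mm'] := leP m m'.
    by case: (nested _ _ _ _ mm' gQ gS); [constructor 2|constructor 3].
  rewrite setIC.
  by case: (nested _ _ _ _ mm' gS gQ); [constructor 1|constructor 3].
- move=> k.
  have genk Q : grid n delta (location a) Q /\
      (exists b : 'rV[R]_d, Q = hocube b (n%:R ^ k)) ->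
      generation n delta (location a) (- k) Q.
    case=> -[m _ gQ] [b Qb].
    have [c Qc] := generation_hocube gQ.
    have : n%:R ^ k = n%:R ^ (- m) :> R.
      apply: (hocube_side_inj d0 (b:=b) (c:=c)); rewrite ?natr_exprz_gt0//.
      by rewrite -Qb.
    move=> /eqP; rewrite eq_le !ler_eXz2l ?ltr1n// -eq_le => /eqP ->.
    by rewrite opprK.
  split.
  + apply/seteqP; split=> // x _.
    have gx : generation n delta (location a) (- k)
        [set y | cell_index delta a (- k) y = cell_index delta a (- k) x].
      by rewrite generationE//; eexists.
    exists [set y | cell_index delta a (- k) y
                    = cell_index delta a (- k) x] => //.
    split; first by exists (- k) => //; exact: gx.
    by have [b ->] := generation_hocube gx; exists b; rewrite opprK.
  + move=> Q S /genk + /genk; rewrite generationE//.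
    by move=> [i ->] [j ->] [x [/= <- <-]].
  + move=> Q [_ [b ->]]; exists b => s; rewrite in_itv/= lexx ltrDl.
    exact: natr_exprz_gt0.
Qed.

(** The constant [C] of an adjacency statement and the discrete scale of a grid
    are compared by rounding [x = C * l] up to a power of [n], at the cost of a
    factor [n]. *)
Lemma exists_generation_scale (R : realType) (n : nat) (n2 : (2 <= n)%N)
    (x : R) :
  0 < x -> exists m : int, x <= n%:R ^ (- m) <= n%:R * x.
Proof.
move=> x0; have n1 : 1 < n%:R :> R by rewrite ltr1n.
have n0 : n%:R != 0 :> R by rewrite pnatr_eq0; lia.
have big (y : R) : exists N : nat, y < n%:R ^ N.
  exists (Num.bound `|y|).
  apply: (le_lt_trans (ler_norm _)).
  apply: (lt_trans (archi_boundP (normr_ge0 y))).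
  by rewrite -exprnP -natrX ltr_nat ltn_expl.
have [N xN] := big x; have [M xM] := big x^-1.
(* The exponents are shifted by [M] so that [P] fails at [0]; the least [k] with
   [P k] then gives the smallest power of [n] that is at least [x]. *)
pose P (k : nat) := x <= n%:R ^ (k%:Z - M%:Z).
have exP : exists k, P k.
  by exists (N + M)%N; rewrite /P PoszD addrK; exact: ltW.
have P0 : ~~ P 0%N.
  rewrite /P -ltNge sub0r -invr_expz.
  by rewrite -[ltRHS]invrK ltf_pV2 // posrE ?natr_exprz_gt0 ?invr_gt0.
have [[|k] Pk kmin] := ex_minnP exP; first by rewrite Pk in P0.
exists (M%:Z - k.+1%:Z); rewrite opprB [X in X && _]Pk/=.
have : ~~ P k by apply/negP => /kmin; rewrite ltnn.
rewrite /P -ltNge => /ltW kx.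
have -> : k.+1%:Z - M%:Z = 1 + (k%:Z - M%:Z) by lia.
by rewrite expfzDr// expr1z ler_pM2l// ltr0n; lia.
Qed.

(** * Projections *)

Lemma cell_index_proj (R : realType) (d n : nat)
    (delta : 'rV[R]_d) (a : nat -> 'rV['I_n]_d) (j : 'I_d) (m : int)
    (x : 'rV[R]_d) (s : 'I_1) :
  cell_index (coord_proj j delta) (fun i => \row_(_ < 1) a i 0 j) m
    (coord_proj j x) 0 s = cell_index delta a m x 0 j.
Proof.
rewrite !mxE /offset; case: ifP => _; rewrite !mxE//.
by under eq_bigr do rewrite mxE.
Qed.

(** The projected grid is again of the form [grid n delta (location a)], so what
    is proved for grids in dimension [d] also applies to it, with dimension
    [1]. *)
Lemma grid_projE (R : realType) (d n : nat) (n2 : (2 <= n)%N)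
    (delta : 'rV[R]_d) (a : nat -> 'rV['I_n]_d) (j : 'I_d) :
  grid_proj j (grid n delta (location a)) =
  grid n (coord_proj j delta) (location (fun i => \row_(_ < 1) a i 0 j)).
Proof.
have E m (k : 'rV[int]_d) :
    coord_proj j @` [set x | cell_index delta a m x = k] =
    [set t | cell_index (coord_proj j delta) (fun i => \row_(_ < 1) a i 0 j) m t
             = \row_(_ < 1) k 0 j].
  apply/seteqP; split=> [_ [x /= xk <-]|t tk].
    by apply/rowP => s; rewrite cell_index_proj xk mxE.
  (* A point over [t]: the other coordinates are the lower corner of cell [k]. *)
  pose x : 'rV[R]_d := \row_s if s == j then t 0 0 else
    offset delta (location a) m 0 s + (k 0 s)%:~R / n%:R ^ m.
  have xt : coord_proj j x = t.
    by apply/rowP => s; rewrite !mxE eqxx ord1.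
  exists x => //=; apply/rowP => s.
  have [->|sj] := eqVneq s j.
    by rewrite -(cell_index_proj _ _ _ _ _ 0) xt tk mxE.
  rewrite !mxE (negbTE sj) addrAC subrr add0r divfK ?intrKfloor//.
  by rewrite gt_eqF// natr_exprz_gt0.
apply/seteqP; split=> [_ [Q [m _ gQ] <-]|Q [m _ gQ]].
  exists m => //; move: gQ; rewrite !generationE// => -[k ->].
  by exists (\row_(_ < 1) k 0 j); rewrite E.
move: gQ; rewrite generationE// => -[k ->].
exists [set x | cell_index delta a m x = const_mx (k 0 0)].
  by exists m => //; rewrite generationE//; eexists.
have kE : \row_(_ < 1) (const_mx (k 0 0) : 'rV[int]_d) 0 j = k.
  by apply/rowP => s; rewrite !mxE ord1.
by rewrite E kE.
Qed.

Lemma coord_proj_cube (R : realType) (d : nat) (Q : set 'rV[R]_d) (l : R)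
    (j : 'I_d) : is_cube Q l -> is_cube (coord_proj j @` Q) l.
Proof.
case=> l0 [p [b [c ->]]]; split=> //.
exists (coord_proj j p), (fun=> b j), (fun=> c j).
apply/seteqP; split=> [_ [x /= xQ <-] s|t tQ].
  by rewrite !mxE; exact: xQ.
exists (\row_s if s == j then t 0 0 else p 0 s + l / 2); last first.
  by apply/rowP => s; rewrite !mxE eqxx ord1.
move=> s; rewrite !mxE; case: eqVneq => [->|_].
  by have := tQ 0; rewrite mxE.
by case: (b s) (c s) => -[]; rewrite in_itv/=; lra.
Qed.

Lemma is_cube_neq0 (R : realType) (d : nat) (Q : set 'rV[R]_d) (l : R) :
  is_cube Q l -> Q !=set0.
Proof.
case=> l0 [p [b [c ->]]]; exists (\row_s (p 0 s + l / 2)) => s.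
by rewrite mxE; case: (b s) (c s) => -[]; rewrite in_itv/=; lra.
Qed.

(** * Adjacency of the grids and of their projections *)

Lemma uniform_constant (R : realType) (T : finType) (P : T -> R -> Prop) :
  (forall t x y, x <= y -> P t x -> P t y) ->
  (forall t, exists2 x, 0 < x & P t x) ->
  exists2 x, 0 < x & forall t, P t x.
Proof.
move=> Pmono exP.
have /choice[f fP] t : exists x, 0 < x /\ P t x.
  by have [x x0 Px] := exP t; exists x.
have f0 t : 0 <= f t by have [/ltW] := fP t.
exists (1 + \sum_t f t) => [|t].
  by rewrite ltr_pwDl// sumr_ge0.
apply: (Pmono t (f t)); last by have [] := fP t.
by rewrite (bigD1 t)//= addrCA lerDl addr_ge0// sumr_ge0.
Qed.

(** Pigeonhole: each coordinate spoils at most one grid, and there are more grids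
    than coordinates. *)
Lemma proj_adjacent_adjacent (R : realType) (d n : nat) (d0 : (0 < d)%N)
    (n2 : (2 <= n)%N) (delta : 'I_d.+1 -> 'rV[R]_d)
    (a : 'I_d.+1 -> nat -> 'rV['I_n]_d) :
  (forall (j : 'I_d) (k1 k2 : 'I_d.+1), k1 <> k2 ->
     adjacent2 n (grid_proj j (grid n (delta k1) (location (a k1))))
                 (grid_proj j (grid n (delta k2) (location (a k2))))) ->
  adjacent n (fun i => grid n (delta i) (location (a i))).
Proof.
move=> adj; split=> [i|]; first exact: grid_is_nadic.
pose G j i := grid_proj j (grid n (delta i) (location (a i))).
have [C C0 adjC] : exists2 C : R, 0 < C & forall p : 'I_d * 'I_d.+1 * 'I_d.+1,
    p.1.2 <> p.2 -> forall Q l, is_cube Q l -> exists k S r,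
      [/\ k = p.1.2 \/ k = p.2, G p.1.1 k S, is_cube S r, Q `<=` S & r <= C * l].
  apply: uniform_constant => [p x y xy Px k12 Q l cQ|[[j k1] k2] /=].
    have [k [S [r [kp gS cS QS rl]]]] := Px k12 Q l cQ.
    exists k, S, r; split=> //; apply: le_trans rl _.
    by rewrite ler_wpM2r//; case: cQ => /ltW.
  have [->|/eqP k12] := eqVneq k1 k2; first by exists 1.
  have [_ [C C0 adjC]] := adj j _ _ k12.
  exists C => // _ Q l /adjC[i [S [r [gS cS QS rl]]]].
  by case: ifP gS => _ gS; [exists k1|exists k2]; exists S, r; split=> //;
    [left|right].
exists (n%:R * C) => [|Q l cQ]; first by rewrite mulr_gt0// ltr0n; lia.
have l0 : 0 < l by case: cQ.
have [m /andP[Cm mC]] := exists_generation_scale n2 (mulr_gt0 C0 l0).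
pose fits i j := forall x y, Q x -> Q y ->
  cell_index (delta i) (a i) m x 0 j = cell_index (delta i) (a i) m y 0 j.
have fit1 j k1 k2 : k1 <> k2 -> fits k1 j \/ fits k2 j.
  move=> k12.
  have [k [S [r [kp gS cS QS rl]]]] :=
    adjC (j, k1, k2) k12 _ _ (coord_proj_cube j cQ).
  suff : fits k j by case: kp => /= ->; [left|right].
  move=> x y Qx Qy.
  rewrite -(cell_index_proj _ _ _ _ x 0) -(cell_index_proj _ _ _ _ y 0).
  move: gS; rewrite /G grid_projE// => gS.
  by apply: (grid_cube_same_index (ltn0Sn 0) n2 0 gS cS (le_trans rl Cm)) => //;
    apply: QS; [exists x|exists y].
have [i fi] : exists i, forall j, fits i j.
  apply: contrapT => nofit.
  (* Otherwise [f] sends each grid to a coordinate in which it separates points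
     of [Q], and two grids cannot share a coordinate. *)
  have /choice[f fP] i : exists j, ~ fits i j.
    apply: contrapT => H; apply: nofit; exists i => j.
    by apply: contrapT => H'; apply: H; exists j.
  have /leq_card : injective f.
    move=> k1 k2 fk; apply: contrapT => k12.
    by have [/fP|] := fit1 (f k1) _ _ k12; [|rewrite fk => /fP].
  by rewrite !card_ord ltnn.
have [S [gS cS QS]] := same_index_grid_cube n2 (is_cube_neq0 cQ)
  (fun x y j Qx Qy => fi j x y Qx Qy).
by exists i, S, (n%:R ^ (- m)); split=> //; rewrite -mulrA.
Qed.

(** A bad interval for two projected grids would extend to a bad cube for all the
    grids, as the [d - 1] free coordinates suffice to defeat the [d - 1] other
    grids. *)
Lemma adjacent_proj_adjacent (R : realType) (d n : nat) (d0 : (0 < d)%N)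
    (n2 : (2 <= n)%N) (delta : 'I_d.+1 -> 'rV[R]_d)
    (a : 'I_d.+1 -> nat -> 'rV['I_n]_d) (j : 'I_d) (k1 k2 : 'I_d.+1) :
  adjacent n (fun i => grid n (delta i) (location (a i))) -> k1 <> k2 ->
  adjacent2 n (grid_proj j (grid n (delta k1) (location (a k1))))
              (grid_proj j (grid n (delta k2) (location (a k2)))).
Proof.
move=> [_ [C C0 adjC]] /eqP k12; split=> [i|].
  by case: ifP => _; rewrite grid_projE//; exact: grid_is_nadic.
exists (n%:R * C) => [|I l cI]; first by rewrite mulr_gt0// ltr0n; lia.
have l0 : 0 < l by case: cI.
have [m /andP[Cm mC]] := exists_generation_scale n2 (mulr_gt0 C0 l0).
have [t0 It0] := is_cube_neq0 cI.
case: (cI) => _ [p [b [c IE]]].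
have [j' k1E _] : {j' | k1 = lift k2 j' & unlift k2 k1 = Some j'}.
  by apply: unlift_some; rewrite eq_sym.
(* The grids other than [k2] are numbered by [lift k2], and the transposition
   arranges that [k1] is matched with [j].  Then [tau] is a bijection of the
   coordinates other than [j] onto the grids other than [k1] and [k2]. *)
pose tau s := lift k2 (tperm j j' s).
(* In a coordinate [s] other than [j] the cube is centred at the boundary point
   [q s] of the cells of the grid [tau s]. *)
pose q s : R := offset (delta (tau s)) (location (a (tau s))) m 0 s.
pose Q : set 'rV[R]_d := [set x | I (coord_proj j x) /\
  forall s, s != j -> x 0 s \in `[q s - l / 2, q s - l / 2 + l[ ].
have cQ : is_cube Q l.
  split=> //; exists (\row_s if s == j then p 0 0 else q s - l / 2).
  exists (fun s => if s == j then b 0 else true).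
  exists (fun s => if s == j then c 0 else true).
  rewrite /Q IE; apply/seteqP; split=> x /= => [[xI xq] s|xQ].
    rewrite mxE; case: eqVneq => [->|/xq//].
    by have := xI 0; rewrite !mxE.
  split=> [s|s sj].
    by have := xQ j; rewrite !mxE eqxx ord1.
  by have := xQ s; rewrite !mxE (negbTE sj).
pose ext (t : 'rV[R]_1) (u : 'I_d -> R) : 'rV[R]_d :=
  \row_s if s == j then t 0 0 else u s.
have extI t u : coord_proj j (ext t u) = t.
  by apply/rowP => s; rewrite !mxE eqxx ord1.
have extQ t u : I t -> (forall s, q s - l / 2 <= u s < q s - l / 2 + l) ->
    Q (ext t u).
  move=> It uq; split; first by rewrite extI.
  by move=> s sj; rewrite mxE (negbTE sj) in_itv/= uq.
have ql s : q s - l / 2 <= q s - l / 2 < q s - l / 2 + l by lra.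
have qm s : q s - l / 2 <= q s < q s - l / 2 + l by lra.
have [i [S [r [gS cS QS rl]]]] := adjC Q l cQ.
have iQ x y s : Q x -> Q y ->
    cell_index (delta i) (a i) m x 0 s = cell_index (delta i) (a i) m y 0 s.
  move=> /QS Sx /QS Sy.
  exact: (grid_cube_same_index d0 n2 _ gS cS (le_trans rl Cm)).
have ik : i = k1 \/ i = k2.
  have [->|ik2] := eqVneq i k2; first by right.
  left; have [i' iE _] : {i' | i = lift k2 i' & unlift k2 i = Some i'}.
    by apply: unlift_some; rewrite eq_sym.
  have tauE : tau (tperm j j' i') = i by rewrite /tau tpermK -iE.
  have [sj|sj] := eqVneq (tperm j j' i') j.
    by rewrite -tauE sj /tau tpermL -k1E.
  move: (tperm j j' i') tauE sj => s tauE sj.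
  (* The index of the grid [i] is [0] at the boundary point [q s], and negative
     at the lower end of the side of [Q]. *)
  have := iQ _ _ s (extQ t0 _ It0 ql) (extQ t0 _ It0 qm).
  rewrite !mxE (negbTE sj) -tauE -/(q s) subrr mul0r floor0 => q0.
  have : 0 <= (q s - l / 2 - q s) * n%:R ^ m by rewrite -floor_ge0 q0.
  rewrite pmulr_lge0 ?natr_exprz_gt0// addrAC subrr add0r oppr_ge0.
  by rewrite leNgt divr_gt0.
have [S' [gS' cS' IS']] : exists S',
    [/\ grid_proj j (grid n (delta i) (location (a i))) S',
        is_cube S' (n%:R ^ (- m)) & I `<=` S'].
  rewrite grid_projE//; apply: same_index_grid_cube => // [|x y s Ix Iy].
    by exists t0.
  rewrite -(extI x (fun s => q s - l / 2)) -(extI y (fun s => q s - l / 2)).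
  by rewrite !cell_index_proj; apply: iQ; apply: extQ.
case: ik gS' => -> gS'; [exists ord0|exists ord_max]; exists S', (n%:R ^ (- m));
  by split=> //; rewrite -mulrA.
Qed.

Unset Implicit Arguments.

Theorem theorem1p6 (R : realType) (d n : nat) (hd : (1 <= d)%N) (hn : (2 <= n)%N)
    (G : 'I_d.+1 -> set (set 'rV[R]_d))
    (hG : forall i : 'I_d.+1, nadic_grid n (G i))
    (delta : 'I_d.+1 -> 'rV[R]_d)
    (a : 'I_d.+1 -> nat -> 'rV['I_n]_d)
    (hGE : forall i : 'I_d.+1, G i = grid n (delta i) (location (a i))) :
  adjacent n G <->
  (forall (j : 'I_d) (k1 k2 : 'I_d.+1), k1 <> k2 ->
     adjacent2 n (grid_proj j (G k1)) (grid_proj j (G k2))).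
Proof.
have -> : G = fun i => grid n (delta i) (location (a i)) by apply/funext.
split=> [adj j k1 k2|]; first exact: adjacent_proj_adjacent.
exact: proj_adjacent_adjacent.
Qed.
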